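(* Let $\lambda,\mu,R,C>0$, and let $q_r^{(i)}$, $p_r^{(i)}$ and $R_{max}^{(i)}$ denote the revenue-maximizing induced joining fraction, the revenue-maximizing entrance fee and the maximum provider revenue under regime $i$, where $i=ind$ (independent customers) or $i=gr$ (grouped customers). Then $$q_r^{(gr)}\le q_r^{(ind)},\qquad p_r^{(gr)}\le p_r^{(ind)},\qquad R_{max}^{(gr)}\le R_{max}^{(ind)}.$$
   Context: Setting: unobservable M/M/1 queue with potential Poisson arrival rate $\lambda>0$, service rate $\mu>0$, service reward $R>0$, waiting cost rate $C>0$ per unit of time in system, and entrance fee $p\in[0,R)$. Put $\rho=\lambda/\mu$ (any positive value allowed), $\nu=R\mu/C$ and $\nu(p)=(R-p)\mu/C$. If a fraction $q\in[0,1]$ of customers joins and $\rho q<1$, the mean sojourn time is $\frac{1}{\mu(1-\rho q)}$; if $\rho q\ge 1$ the expected waiting cost is infinite, so such $q$ are excluded. Independent behavior: $q_e^{(ind)}(p)$ is the unique symmetric equilibrium joining probability, i.e. the unique $q\in[0,1]$ with $\rho q<1$ such that $q$ maximizes $q'\mapsto q'\left(R-p-\frac{C}{\mu(1-\rho q)}\right)$ over $q'\in[0,1]$. It is known that $q_e^{(ind)}(p)=\min\left\{\frac1\rho\left(1-\frac{1}{\nu(p)}\right)^+,1\right\}$, where $x^+=\max(x,0)$. Grouped behavior: $q_e^{(gr)}(p)$ is the unique maximizer, over $q\in[0,1]$ with $\rho q<1$, of the aggregate customer surplus per unit time $\mathcal U^{(gr)}(q;p)=\lambda q\left(R-p-\frac{C}{\mu-\lambda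 q}\right)=C\rho q\left(\nu(p)-\frac{1}{1-\rho q}\right)$. Provider: for $i\in\{ind,gr\}$ the provider's revenue per unit time at fee $p$ is $\overline R^{(i)}(p)=\lambda\, q_e^{(i)}(p)\,p$, and $R_{max}^{(i)}=\max_{p\in[0,R)}\overline R^{(i)}(p)$. When $\nu>1$, $p_r^{(i)}$ is the (unique) fee in $[0,R)$ attaining this maximum. When $\nu\le 1$, demand and revenue are zero at every fee and one sets $p_r^{(i)}=0$ as a normalization. In both cases $q_r^{(i)}=q_e^{(i)}(p_r^{(i)})$. *)

(* Defs.v *)
From HB Require Import structures.
From mathcomp Require Import all_boot all_order all_algebra.
From mathcomp Require Import all_classical all_reals.

Set Implicit Arguments.
Unset Strict Implicit.
Unset Printing Implicit Defensive.

Import Order.TTheory GRing.Theory Num.Theory.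
Local Open Scope classical_set_scope.
Local Open Scope ring_scope.

(* Unobservable M/M/1 queue with potential arrival rate [lambda], service rate
   [mu], service reward [R], waiting cost rate [C] and entrance fee [p]; a
   fraction [q] of the customers joins.

   Quantities that are "the unique x such that ..." are written
   [xget 0 [set x | ...]]: an element of the set, or the irrelevant value 0 if
   the set is empty.  All sets so used are singletons when the parameters
   are positive and [p] lies in [0, R[ (for the optimal fee: when [1 < nu]). *)

Inductive regime := ind | gr.

Definition argmax (K : realType) (A : set K) (f : K -> K) : set K :=
  [set x | A x /\ forall y, A y -> f y <= f x].

Definition rho (K : realType) (lambda mu : K) : K := lambda / mu.

Definition nu (K : realType) (mu R C : K) : K := R * mu / C.

(* Joining fractions with a finite expected waiting cost. *)
Definition stable_fractions (K : realType) (lambda mu : K) : set K :=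
  [set q | 0 <= q <= 1 /\ rho lambda mu * q < 1].

Definition mean_sojourn (K : realType) (lambda mu q : K) : K :=
  1 / (mu * (1 - rho lambda mu * q)).

(* Expected payoff of a customer joining with probability [q'] when the others
   join with probability [q]. *)
Definition payoff (K : realType) (lambda mu R C p q q' : K) : K :=
  q' * (R - p - C * mean_sojourn lambda mu q).

Definition equilibria (K : realType) (lambda mu R C p : K) : set K :=
  [set q | stable_fractions lambda mu q /\
           argmax [set` `[0, 1]%R] (payoff lambda mu R C p q) q].

(* Aggregate customer surplus per unit time. *)
Definition surplus (K : realType) (lambda mu R C p q : K) : K :=
  lambda * q * (R - p - C / (mu - lambda * q)).

Definition q_e (K : realType) (i : regime) (lambda mu R C p : K) : K :=
  match i with
  | ind => xget 0 (equilibria lambda mu R C p)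
  | gr => xget 0 (argmax (stable_fractions lambda mu)
                         (surplus lambda mu R C p))
  end.

Definition revenue (K : realType) (i : regime) (lambda mu R C p : K) : K :=
  lambda * q_e i lambda mu R C p * p.

(* The maximum of the revenue over the fees in [0, R[, not merely its
   supremum: the value has to be attained. *)
Definition R_max (K : realType) (i : regime) (lambda mu R C : K) : K :=
  let revenues := revenue i lambda mu R C @` [set` `[0, R[%R] in
  xget 0 [set m | revenues m /\ ubound revenues m].

(* For [nu <= 1] every fee yields zero revenue, and the fee is normalized. *)
Definition p_r (K : realType) (i : regime) (lambda mu R C : K) : K :=
  if 1 < nu mu R C
  then xget 0 (argmax [set` `[0, R[%R] (revenue i lambda mu R C))
  else 0.

Definition q_r (K : realType) (i : regime) (lambda mu R C : K) : K :=
  q_e i lambda mu R C (p_r i lambda mu R C).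

(* Main.v *)
Require Import Defs.
From HB Require Import structures.
From mathcomp Require Import all_boot all_order all_algebra.
From mathcomp Require Import all_classical all_reals.
From mathcomp Require Import ring lra.

Import Order.TTheory GRing.Theory Num.Theory.
Local Open Scope ring_scope.

(** In terms of the idle probability [t = 1 - rho q], the fraction induced by a
    fee [p] is determined by comparing the normalized net reward [nu(p)] with
    [1 / t] (independent customers) or [1 / t ^ 2] (grouped customers).
    Choosing the fee thus amounts to choosing [q] so as to maximize
    [q (nu - 1 / t)], respectively [q (nu - 1 / t ^ 2)].  The first-order
    conditions compare [nu] with [1 / t ^ 2], respectively [(2 - t) / t ^ 3],
    and the three inequalities follow by comparing these functions of [t]. *)

(* [price i] is the normalized net reward [nu(p)] at which regime [i] settles
   at idle probability [t]; [marginal i] is the derivative of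
   [x * price i (1 - x)] with respect to [x], taken at [x = 1 - t]. *)
Definition price {K : realType} (i : regime) (t : K) : K :=
  match i with ind => t^-1 | gr => (t ^+ 2)^-1 end.

Definition marginal {K : realType} (i : regime) (t : K) : K :=
  match i with ind => (t ^+ 2)^-1 | gr => (2 - t) / t ^+ 3 end.

(** Up to the factor [C * r], this is the revenue when the provider induces [q] at the highest
    possible fee. With [i = ind] it is also, up to that factor, the surplus of grouped customers. *)
Definition profit {K : realType} (i : regime) (r w q : K) : K :=
  q * (w - price i (1 - r * q)).

Definition stable {K : realType} (r q : K) : Prop := 0 <= q <= 1 /\ r * q < 1.

(* The Karush-Kuhn-Tucker conditions on [[0, 1]] for the level [w] of [h]. *)
Definition clears {K : realType} (h : K -> K) (r w q : K) : Prop :=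
  [/\ stable r q, 0 < q -> h (1 - r * q) <= w & q < 1 -> w <= h (1 - r * q)].

Section Idle.
Variable K : realType.
Implicit Types (i : regime) (h : K -> K) (r w q t u : K).

(** * Monotonicity and ordering of [price] and [marginal] *)

Lemma price1 i : price i 1 = 1 :> K.
Proof. by case: i; rewrite /= ?expr1n invr1. Qed.

Lemma marginal1 i : marginal i 1 = 1 :> K.
Proof. by case: i => /=; rewrite !expr1n ?invr1 //; lra. Qed.

Lemma price_gt0 i t : 0 < t -> 0 < price i t.
Proof. by case: i => t0; rewrite /= invr_gt0 ?exprn_gt0. Qed.

Lemma price_lt i t u : 0 < t -> t < u -> price i u < price i t.
Proof.
case: i => t0 tu /=; have u0 := lt_trans t0 tu.
  by rewrite ltf_pV2 ?posrE.
by rewrite ltf_pV2 ?posrE ?exprn_gt0 // ltr_pXn2r // nnegrE ltW.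
Qed.

Lemma marginal_lt i t u : 0 < t -> t < u -> u <= 1 ->
  marginal i u < marginal i t.
Proof.
case: i => t0 tu u1; first exact: (@price_lt gr).
have u0 := lt_trans t0 tu.
rewrite /= ltr_pdivrMr ?exprn_gt0 // mulrAC ltr_pdivlMr ?exprn_gt0 //.
apply: ltr_pM; rewrite ?exprn_ge0 ?ltW //; first by lra.
  by lra.
by rewrite ltr_pXn2r // nnegrE ltW.
Qed.

Lemma price_ind_le_gr t : 0 < t -> t <= 1 -> price ind t <= price gr t.
Proof.
move=> t0 t1 /=; rewrite lef_pV2 ?posrE ?exprn_gt0 //.
by rewrite expr2 ler_piMr // ltW.
Qed.

Lemma marginal_ind_le_gr t : 0 < t -> t <= 1 -> marginal ind t <= marginal gr t.
Proof.
move=> t0 t1 /=; rewrite ler_pdivlMr ?exprn_gt0 //.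
rewrite [t ^+ 3]exprS mulrC mulfK ?expf_neq0 ?gt_eqF //; lra.
Qed.

Lemma stable_idle r q : 0 < r -> stable r q -> 0 < 1 - r * q <= 1.
Proof.
by move=> r0 [/andP[q0 q1] rq]; have := mulr_ge0 (ltW r0) q0; lra.
Qed.

(** * Existence of clearing fractions *)

(** For [w <= 1] take [q = 0]; otherwise solve [h t = w] and truncate [(1 - t) / r] at 1. *)
Lemma clears_exists h r w : 0 < r -> h 1 = 1 ->
  (forall t u, 0 < t -> t < u -> u <= 1 -> h u < h t) ->
  (1 < w -> exists2 t, 0 < t <= 1 & h t = w) -> exists q, clears h r w q.
Proof.
move=> r0 h1 hlt hw; have [w1|/hw[t /andP[t0 t1] htw]] := leP w 1.
  by exists 0; split; [split; lra | lra | rewrite mulr0 subr0 h1].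
have [tr|tr] := leP (1 - r) t.
  have E : 1 - r * ((1 - t) / r) = t by field; rewrite gt_eqF.
  exists ((1 - t) / r); split; [split | |]; rewrite ?E ?htw //; last by lra.
  by apply/andP; split; rewrite ?ler_pdivrMr // ?divr_ge0 //; lra.
exists 1; split; [split; lra | | by rewrite ltxx].
by rewrite mulr1 -htw => _; apply/ltW/hlt => //; lra.
Qed.

Lemma sqrt_idle w : 1 < w ->
  exists2 t : K, 0 < t <= 1 & (t ^+ 2)^-1 = w.
Proof.
move=> w1; have w0 : 0 < w by lra.
exists (Num.sqrt w)^-1; last by rewrite exprVn invrK sqr_sqrtr ?ltW.
rewrite invr_gt0 sqrtr_gt0 w0 invf_le1 ?sqrtr_gt0 //.
by rewrite -(sqrtr1 K) ler_wsqrtr ?ltW.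
Qed.

Lemma cubic_idle w : 1 < w ->
  exists2 t : K, 0 < t <= 1 & (2 - t) / t ^+ 3 = w.
Proof.
(* The equation is cleared of its denominator; the polynomial is -2 at 0 and [w - 1 > 0] at 1. *)
move=> w1; pose p : {poly K} := w *: 'X^3 + 'X - 2%:P.
have pE t : p.[t] = w * t ^+ 3 + t - 2.
  by rewrite /p !hornerE.
have [|t /andP[t0 t1] /rootP] := @poly_ivt K p 0 1 ler01.
  by rewrite !pE; lra.
rewrite pE => pt; have tn0 : t != 0.
  by apply/eqP => t0'; move: pt; rewrite t0'; lra.
exists t; first by rewrite lt_def tn0 t0.
by apply: (canLR (mulfK (expf_neq0 3 tn0))); lra.
Qed.

Lemma clears_price_exists i r w : 0 < r -> exists q, clears (price i) r w q.
Proof.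
move=> r0; apply: clears_exists => //; first exact: price1.
  by move=> t u t0 tu _; apply: price_lt.
case: i => w1; last exact: sqrt_idle.
by exists w^-1; rewrite /= ?invrK // invr_gt0 invf_le1; lra.
Qed.

Lemma clears_marginal_exists i r w :
  0 < r -> exists q, clears (marginal i) r w q.
Proof.
move=> r0; apply: clears_exists => //; first exact: marginal1.
  exact: marginal_lt.
by case: i => w1; [exact: sqrt_idle | exact: cubic_idle].
Qed.

(** * Positivity and uniqueness of clearing fractions *)

Lemma clears_gt0 h r w q : h 1 = 1 -> 1 < w -> clears h r w q -> 0 < q.
Proof.
move=> h1 w1 [[/andP[q0 _] _] _ qw]; rewrite lt_def q0 andbT; apply/eqP => q00.
by move: qw; rewrite q00 mulr0 subr0 h1 ltr01 => /(_ isT); lra.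
Qed.

(** If [q < q'], the price at [q'] is strictly higher, yet [w] is at least that price and at most
    the price at [q]. *)
Lemma clears_price_le i r w q q' : 0 < r ->
  clears (price i) r w q -> clears (price i) r w q' -> q' <= q.
Proof.
move=> r0 [sq _ qw] [sq' wq' _]; have [//|qq'] := leP q' q.
have [/andP[q0 _] _] := sq; have [/andP[_ q1] _] := sq'.
have /andP[t0 _] := stable_idle _ _ r0 sq'.
have := price_lt i _ (1 - r * q) t0.
rewrite ltrD2l ltrN2 ltr_pM2l // => /(_ qq').
have := qw (lt_le_trans qq' q1); have := wq' (le_lt_trans q0 qq'); lra.
Qed.

Lemma clears_price_uniq i r w q q' : 0 < r ->
  clears (price i) r w q -> clears (price i) r w q' -> q' = q.
Proof.
move=> r0 cq cq'; apply/eqP.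
by rewrite eq_le (clears_price_le i r w q q') ?(clears_price_le i r w q' q).
Qed.

Lemma clears_price_eq0 i r w q : 0 < r -> w <= 1 ->
  clears (price i) r w q -> q = 0.
Proof.
move=> r0 w1 /(clears_price_uniq i _ _ 0 _ r0); apply.
by split; [split; lra | lra | rewrite mulr0 subr0 price1].
Qed.

(** * Sufficiency of the first-order conditions *)

(* The slope of [x * price i (1 - x)] between [x = 1 - t] and [x = 1 - u]. *)
Definition secant i t u : K :=
  match i with ind => (t * u)^-1 | gr => (t + u - t * u) / (t * u) ^+ 2 end.

(** This exact factorization takes the place of differential calculus in the optimality proof. *)
Lemma profit_diff i r w q q' : 1 - r * q != 0 -> 1 - r * q' != 0 ->
  profit i r w q - profit i r w q' =
  (q - q') * (w - secant i (1 - r * q) (1 - r * q')).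
Proof.
move=> t0 u0; rewrite /profit /secant; case: i => /=.
  by field; rewrite t0 u0.
by field; rewrite t0 u0.
Qed.

(** Strict convexity of [x * price i (1 - x)]: the difference of the two sides is [u - t] times a
    positive rational expression. *)
Lemma secant_lt_marginal i t u : 0 < t -> t < u -> u <= 1 ->
  secant i t u < marginal i t.
Proof.
move=> t0 tu u1; have u0 := lt_trans t0 tu; rewrite -subr_gt0.
have tn0 : t != 0 by rewrite gt_eqF.
have un0 : u != 0 by rewrite gt_eqF.
case: i => /=.
  have -> : (t ^+ 2)^-1 - (t * u)^-1 = (u - t) / (t ^+ 2 * u).
    by field; rewrite tn0 un0.
  by rewrite divr_gt0 ?mulr_gt0 ?exprn_gt0 // subr_gt0.
have -> : (2 - t) / t ^+ 3 - (t + u - t * u) / (t * u) ^+ 2 =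
   (u - t) * ((2 - t) * u + t) / (t ^+ 3 * u ^+ 2).
  by field; rewrite tn0 un0.
rewrite divr_gt0 ?mulr_gt0 ?exprn_gt0 ?subr_gt0 //.
by rewrite addr_gt0 ?mulr_gt0 //; lra.
Qed.

Lemma marginal_lt_secant i t u : 0 < u -> u < t -> t <= 1 ->
  marginal i t < secant i t u.
Proof.
move=> u0 ut t1; have t0 := lt_trans u0 ut; rewrite -subr_gt0.
have tn0 : t != 0 by rewrite gt_eqF.
have un0 : u != 0 by rewrite gt_eqF.
case: i => /=.
  have -> : (t * u)^-1 - (t ^+ 2)^-1 = (t - u) / (t ^+ 2 * u).
    by field; rewrite tn0 un0.
  by rewrite divr_gt0 ?mulr_gt0 ?exprn_gt0 // subr_gt0.
have -> : (t + u - t * u) / (t * u) ^+ 2 - (2 - t) / t ^+ 3 =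
   (t - u) * ((2 - t) * u + t) / (t ^+ 3 * u ^+ 2).
  by field; rewrite tn0 un0.
rewrite divr_gt0 ?mulr_gt0 ?exprn_gt0 ?subr_gt0 //.
by rewrite addr_gt0 ?mulr_gt0 //; lra.
Qed.

Lemma clears_marginal_profit_lt i r w q q' : 0 < r ->
  clears (marginal i) r w q -> stable r q' -> q' != q ->
  profit i r w q' < profit i r w q.
Proof.
move=> r0 [sq wq qw] sq' qq'; rewrite -subr_gt0.
have /andP[t0 t1] := stable_idle _ _ r0 sq.
have /andP[u0 u1] := stable_idle _ _ r0 sq'.
have [/andP[q0 q1] _] := sq; have [/andP[q'0 q'1] _] := sq'.
rewrite profit_diff ?gt_eqF //; move: qq'; rewrite neq_lt => /orP[] qq'.
  rewrite pmulr_rgt0 ?subr_gt0 //; apply: lt_le_trans (wq _); last by lra.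
  by apply: secant_lt_marginal; rewrite // ltrD2l ltrN2 ltr_pM2l.
rewrite nmulr_rgt0 ?subr_lt0 //; apply: le_lt_trans (qw _) _; first by lra.
by apply: marginal_lt_secant; rewrite // ltrD2l ltrN2 ltr_pM2l.
Qed.

Lemma clears_marginal_profit_le i r w q q' : 0 < r ->
  clears (marginal i) r w q -> stable r q' ->
  profit i r w q' <= profit i r w q.
Proof.
move=> r0 cq sq'; have [->//|qq'] := eqVneq q' q.
exact/ltW/clears_marginal_profit_lt.
Qed.

(** * Comparison of the two regimes *)

(** If [q' < q], then [w <= marginal ind u < marginal ind t <= marginal gr t <= w] for the idle
    probabilities [t < u] of [q] and [q']. *)
Lemma clears_marginal_gr_le_ind r w q q' : 0 < r ->
  clears (marginal gr) r w q -> clears (marginal ind) r w q' -> q <= q'.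
Proof.
move=> r0 [sq wq _] [sq' _ qw']; have [//|qq'] := leP q q'.
have [/andP[_ q1] _] := sq; have [/andP[q'0 _] _] := sq'.
have /andP[t0 t1] := stable_idle _ _ r0 sq.
have /andP[_ u1] := stable_idle _ _ r0 sq'.
have tu : 1 - r * q < 1 - r * q' by rewrite ltrD2l ltrN2 ltr_pM2l.
have := wq (le_lt_trans q'0 qq'); have := qw' (lt_le_trans qq' q1).
have := marginal_lt ind _ _ t0 tu u1; have := marginal_ind_le_gr _ t0 t1; lra.
Qed.

Lemma clears_marginal_price_le r w q q' : 0 < r -> 1 < w ->
  clears (marginal gr) r w q -> clears (marginal ind) r w q' ->
  price ind (1 - r * q') <= price gr (1 - r * q).
Proof.
move=> r0 w1 cq cq'; have q'0 := clears_gt0 _ _ _ _ (marginal1 ind) w1 cq'.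
have qq' := clears_marginal_gr_le_ind _ _ _ _ r0 cq cq'.
case: cq cq' => sq _ qw [sq' wq' _].
have [/andP[_ q1] _] := sq; have [/andP[_ q'1] _] := sq'.
have /andP[t0 t1] := stable_idle _ _ r0 sq.
have /andP[u0 u1] := stable_idle _ _ r0 sq'.
(* At the corner [q = 1] also [q' = 1], and the prices compare at the same idle probability. *)
have [q1'|] := ltP q 1; last first.
  move=> q1'; have -> : q' = q by lra.
  exact: price_ind_le_gr.
(* The conditions give [t ^+ 3 <= (2 - t) * u ^+ 2]. Multiplying by [t] and using [t * (2 - t) <= 1]
   yields [t ^+ 4 <= u ^+ 2], hence [t ^+ 2 <= u]. *)
have := le_trans (wq' q'0) (qw q1').
set t := 1 - r * q in t0 t1 *; set u := 1 - r * q' in u0 u1 *.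
rewrite /= ler_pdivlMr ?exprn_gt0 // mulrC ler_pdivrMr ?exprn_gt0 // => tu.
rewrite lef_pV2 ?posrE ?exprn_gt0 //.
rewrite -(@ler_pXn2r _ 2) ?nnegrE ?exprn_ge0 ?(ltW t0) ?(ltW u0) //.
rewrite -exprM [t ^+ _]exprS.
apply: (le_trans (ler_wpM2l (ltW t0) tu)).
rewrite mulrA ler_piMl ?exprn_ge0 ?(ltW u0) //.
by have := sqr_ge0 (t - 1); lra.
Qed.

End Idle.

(** * Translation of the queueing model *)

Section Queue.
Variables (K : realType) (lambda mu R C : K).
Hypotheses (lambda_gt0 : 0 < lambda) (mu_gt0 : 0 < mu) (C_gt0 : 0 < C).
Implicit Types (i : regime) (p q : K).

Let r := rho lambda mu.
Let w p := nu mu (R - p) C.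

Let r_gt0 : 0 < r. Proof. exact: divr_gt0. Qed.

(** Inverse demand: for a stable [q > 0], the largest fee that induces [q]. *)
Definition fee i q : K := R - C / mu * price i (1 - r * q).

Lemma nu_fee i q : w (fee i q) = price i (1 - r * q).
Proof. by rewrite /w /nu /fee; field; rewrite !gt_eqF. Qed.

Lemma payoff_profit p q q' : stable r q ->
  payoff lambda mu R C p q q' = C / mu * (q' * (w p - price ind (1 - r * q))).
Proof.
move=> /(stable_idle _ _ _ r_gt0)/andP[t0 _].
by rewrite /payoff /mean_sojourn /w /nu /= -/r; field; rewrite !gt_eqF.
Qed.

Lemma surplus_profit p q : stable r q ->
  surplus lambda mu R C p q = C * r * profit ind r (w p) q.
Proof.
move=> /(stable_idle _ _ _ r_gt0)/andP[t0 _].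
have tn0 : 1 - r * q != 0 by rewrite gt_eqF.
have E : mu - lambda * q = mu * (1 - r * q).
  by rewrite /r /rho; field; rewrite gt_eqF.
have El : lambda = mu * r by rewrite /r /rho; field; rewrite gt_eqF.
by rewrite /surplus E El /profit /w /nu /=; field; rewrite tn0 !gt_eqF.
Qed.

Lemma equilibria_clears p q :
  equilibria lambda mu R C p q <-> clears (price ind) r (w p) q.
Proof.
have k0 : 0 < C / mu by exact: divr_gt0.
split.
  move=> [sq [_ qmax]]; have {qmax} H q' : 0 <= q' <= 1 ->
      q' * (w p - price ind (1 - r * q)) <= q * (w p - price ind (1 - r * q)).
    move=> q'01; have := qmax q'; rewrite /= in_itv /= q'01 => /(_ isT).
    by rewrite !payoff_profit // ler_pM2l.
  (* The payoff is linear in the deviation, so the deviations 0 and 1 yield the two conditions. *)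
  split=> // q01.
    have := H 0; rewrite lexx ler01 mul0r => /(_ isT).
    by rewrite pmulr_rge0 // subr_ge0.
  have := H 1; rewrite lexx ler01 mul1r => /(_ isT).
  by rewrite -subr_ge0 -[X in _ - X]mul1r -mulrBl nmulr_rge0
     ?subr_le0 ?subr_lt0.
move=> [sq wq qw]; have [/andP[q0 q1] _] := sq.
split=> //; split; first by rewrite /= in_itv /= q0.
move=> q'; rewrite /= in_itv /= => /andP[q'0 q'1].
rewrite !payoff_profit // ler_pM2l // -subr_ge0 -mulrBl.
have [qq'|qq'] := leP q' q.
  have [q_gt0|q_le0] := ltP 0 q; last first.
    have -> : q - q' = 0 by lra.
    by rewrite mul0r.
  by rewrite mulr_ge0 ?subr_ge0 //; apply: wq.
by rewrite mulr_le0 ?subr_le0 ?(ltW qq') //; apply: qw; lra.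
Qed.

Lemma q_e_clears i p : clears (price i) r (w p) (q_e i lambda mu R C p).
Proof.
have [q cq] := @clears_price_exists K i r (w p) r_gt0.
case: i cq => cq /=.
  by apply/equilibria_clears; apply: xgetPex; exists q; apply/equilibria_clears.
(* The grouped customers' surplus has the form of the revenue obtained from
   independent customers, and [marginal ind] is [price gr]. *)
have cmax : clears (marginal ind) r (w p) q by [].
have k0 : 0 < C * r by exact: mulr_gt0.
have qmax : argmax (stable_fractions lambda mu) (surplus lambda mu R C p) q.
  split; first by case: cq.
  move=> q' sq'; rewrite !surplus_profit ?ler_pM2l //; last by case: cq.
  exact: clears_marginal_profit_le.
suff -> : xget 0 (argmax (stable_fractions lambda mu)
                         (surplus lambda mu R C p)) = q by [].
apply: xget_unique => // q' [sq' q'max]; apply/eqP/negPn/negP => qq'.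
have sq : stable r q by case: cq.
have := q'max q sq; rewrite !surplus_profit ?ler_pM2l // leNgt.
by rewrite clears_marginal_profit_lt.
Qed.

Lemma q_e_fee i q : stable r q -> q_e i lambda mu R C (fee i q) = q.
Proof.
move=> sq; have := q_e_clears i (fee i q); rewrite nu_fee => cq.
by apply: clears_price_uniq cq; rewrite //; split.
Qed.

Lemma fee_profit i q : lambda * q * fee i q = C * r * profit i r (nu mu R C) q.
Proof.
rewrite /fee /profit /nu; set c := price _ _.
by rewrite /r /rho; field; rewrite !gt_eqF.
Qed.

Lemma le_fee i p : 0 < q_e i lambda mu R C p ->
  p <= fee i (q_e i lambda mu R C p).
Proof.
move=> q0; have [_ /(_ q0) cw _] := q_e_clears i p.
have pE : p = R - C / mu * w p by rewrite /w /nu; field; rewrite !gt_eqF.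
by rewrite [X in X <= _]pE /fee lerD2l lerN2 ler_pM2l ?divr_gt0.
Qed.

Lemma revenue_le_profit i p :
  revenue i lambda mu R C p <=
  C * r * profit i r (nu mu R C) (q_e i lambda mu R C p).
Proof.
have [[/andP[q0 _] _] _ _] := q_e_clears i p.
rewrite /revenue -fee_profit; move: q0; rewrite le_eqVlt => /orP[/eqP <-|q0].
  by rewrite !mulr0 !mul0r.
by rewrite ler_pM2l ?mulr_gt0 // le_fee.
Qed.

(** * The optimal fee when [1 < nu] *)

Section Optimum.
Variables (i : regime) (q : K).
Hypothesis nu_gt1 : 1 < nu mu R C.
Hypothesis cq : clears (marginal i) r (nu mu R C) q.

Let sq : stable r q. Proof. by case: cq. Qed.

Let q_gt0 : 0 < q.
Proof. by apply: clears_gt0 cq; rewrite ?marginal1. Qed.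

Let k_gt0 : 0 < C * r. Proof. exact: mulr_gt0. Qed.

Lemma revenue_fee :
  revenue i lambda mu R C (fee i q) = C * r * profit i r (nu mu R C) q.
Proof. by rewrite /revenue q_e_fee // fee_profit. Qed.

Lemma fee_range : 0 <= fee i q < R.
Proof.
apply/andP; split; last first.
  rewrite /fee gtrBl mulr_gt0 ?divr_gt0 ?price_gt0 //.
  by have /andP[] := stable_idle _ _ _ r_gt0 sq.
rewrite -(pmulr_rge0 _ (mulr_gt0 lambda_gt0 q_gt0)) fee_profit.
rewrite pmulr_rge0 //.
(* The optimal profit is at least the profit at [q = 0], which is zero. *)
have s0 : stable r 0 by split; lra.
have := clears_marginal_profit_le _ i r _ q 0 r_gt0 cq s0.
by rewrite {1}/profit mul0r.
Qed.

Lemma revenue_le p :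
  revenue i lambda mu R C p <= revenue i lambda mu R C (fee i q).
Proof.
apply: le_trans (revenue_le_profit i p) _; rewrite revenue_fee ler_pM2l //.
by apply: clears_marginal_profit_le => //; case: (q_e_clears i p).
Qed.

Lemma argmax_revenue_fee :
  argmax [set` `[0, R[%R]%classic (revenue i lambda mu R C) (fee i q).
Proof. by split=> [|p _]; rewrite ?revenue_le //= in_itv fee_range. Qed.

(** Strict optimality of [q] forces [p] to induce [q]; then [p] is at most [fee i q], and comparing
    revenues at equal demand gives the converse. *)
Lemma revenue_max_uniq p :
  revenue i lambda mu R C (fee i q) <= revenue i lambda mu R C p ->
  p = fee i q.
Proof.
move=> max_p; have [sp _ _] := q_e_clears i p.
have qpE : q_e i lambda mu R C p = q.
  apply/eqP/negPn/negP => /(clears_marginal_profit_lt _ i r _ _ _ r_gt0 cq sp).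
  rewrite -(ltr_pM2l k_gt0) -revenue_fee.
  move=> /(le_lt_trans (revenue_le_profit i p)).
  by rewrite ltNge max_p.
apply/eqP; rewrite eq_le; apply/andP; split.
  by rewrite -[in X in _ <= X]qpE le_fee // qpE.
move: max_p; rewrite /revenue q_e_fee // qpE.
by rewrite ler_pM2l // mulr_gt0.
Qed.

Lemma p_r_fee : p_r i lambda mu R C = fee i q.
Proof.
rewrite /p_r nu_gt1; apply: xget_unique; first exact: argmax_revenue_fee.
move=> p [_ pmax]; apply: revenue_max_uniq; apply: pmax.
by have [] := argmax_revenue_fee.
Qed.

Lemma q_r_fee : q_r i lambda mu R C = q.
Proof. by rewrite /q_r p_r_fee q_e_fee. Qed.

Lemma R_max_fee : R_max i lambda mu R C = C * r * profit i r (nu mu R C) q.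
Proof.
rewrite -revenue_fee /R_max; have [fR _] := argmax_revenue_fee.
apply: xget_unique.
  by split; [exists (fee i q) | move=> _ [p _ <-]; apply: revenue_le].
move=> m [[p _ <-] pmax]; apply/eqP; rewrite eq_le revenue_le /=.
by apply: pmax; exists (fee i q).
Qed.

End Optimum.

(** * The case without demand, [nu <= 1] *)

Lemma q_e_eq0 i p : nu mu R C <= 1 -> 0 <= p -> q_e i lambda mu R C p = 0.
Proof.
move=> nu1 p0; apply: clears_price_eq0 (q_e_clears i p); rewrite //.
apply: le_trans nu1; rewrite /w /nu ler_pM2r ?invr_gt0 // ler_pM2r //; lra.
Qed.

Lemma R_max_eq0 i : nu mu R C <= 1 -> R_max i lambda mu R C = 0.
Proof.
(* The default of [xget] is 0 too, so only a member of the set has to be examined. *)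
move=> nu1; rewrite /R_max; case: xgetP => // m _ [[p + <-] _].
rewrite /= in_itv => /andP[p0 _].
by rewrite /revenue q_e_eq0 // mulr0 mul0r.
Qed.

End Queue.

Theorem mainTheorem2 (K : realType) (lambda mu R C : K)
    (lambda_gt0 : 0 < lambda) (mu_gt0 : 0 < mu) (R_gt0 : 0 < R) (C_gt0 : 0 < C) :
  [/\ q_r gr lambda mu R C <= q_r ind lambda mu R C,
      p_r gr lambda mu R C <= p_r ind lambda mu R C
    & R_max gr lambda mu R C <= R_max ind lambda mu R C].
Proof.
have [nu1|nu1] := leP (nu mu R C) 1.
  have p_r0 i : p_r i lambda mu R C = 0 by rewrite /p_r ltNge nu1.
  by rewrite /q_r !p_r0 !q_e_eq0 // !R_max_eq0.
have r0 : 0 < rho lambda mu by exact: divr_gt0.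
have [q cq] := clears_marginal_exists _ gr _ (nu mu R C) r0.
have [q' cq'] := clears_marginal_exists _ ind _ (nu mu R C) r0.
have [sq _ _] := cq; have [/andP[q_ge0 _] _] := sq.
rewrite (q_r_fee K _ _ _ _ lambda_gt0 mu_gt0 C_gt0 _ _ nu1 cq).
rewrite (q_r_fee K _ _ _ _ lambda_gt0 mu_gt0 C_gt0 _ _ nu1 cq').
rewrite (p_r_fee K _ _ _ _ lambda_gt0 mu_gt0 C_gt0 _ _ nu1 cq).
rewrite (p_r_fee K _ _ _ _ lambda_gt0 mu_gt0 C_gt0 _ _ nu1 cq').
rewrite (R_max_fee K _ _ _ _ lambda_gt0 mu_gt0 C_gt0 _ _ nu1 cq).
rewrite (R_max_fee K _ _ _ _ lambda_gt0 mu_gt0 C_gt0 _ _ nu1 cq').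
split.
- exact: clears_marginal_gr_le_ind cq cq'.
- rewrite /fee lerD2l lerN2 ler_pM2l; last exact: divr_gt0.
  exact: clears_marginal_price_le cq cq'.
rewrite ler_pM2l; last exact: mulr_gt0.
(* The grouped optimum [q] is a candidate for independent customers as well, and there it sells at a
   price term no larger than [price gr]. *)
apply: le_trans (clears_marginal_profit_le _ ind _ _ _ q r0 cq' sq).
have /andP[t0 t1] := stable_idle _ _ _ r0 sq.
by rewrite /profit ler_wpM2l // lerD2l lerN2 price_ind_le_gr.
Qed.
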